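(* Let $t$ and $c$ be positive integers. Let $G$ be a graph and $T_1,\ldots,T_t$ even-cardinality subsets of $V(G)$ such that a $(T_1,\ldots,T_t)$-even cut exists, and let $k$ be the minimum size of a $(T_1,\ldots,T_t)$-even cut. If the Random Contraction Algorithm (described below) is run independently $c|V(G)|^4$ times on $(G;T_1,\ldots,T_t)$, the probability that none of the runs returns a $(T_1,\ldots,T_t)$-even cut of size $k$ is at most $e^{-24c}$.
   Context: For $X\subseteq V(G)$, $\delta_G(X)$ is the set of edges with one end in $X$ and the other outside $X$. A $(T_1,\ldots,T_t)$-even cut is a set $\delta_G(X)$ with $\emptyset\subsetneq X\subsetneq V(G)$ and $|T_i\cap X|$ even for all $i$. For an edge $e$ with ends $x,y$, let $G/e$ be obtained by contracting $e$ to a new vertex $z$, and for each $i$ let $T_i'$ be the unique even-cardinality subset of $V(G/e)$ with $T_i\setminus\{x,y\}=T_i'\setminus\{z\}$; write $(G;T_1,\ldots,T_t)/e=(G/e;T_1',\ldots,T_t')$. The Random Contraction Algorithm, on such an instance: Step 1: delete the loops of $G$. Step 2: if $|V(G)|\le 2^t+4$, find a minimum-cardinality $(T_1,\ldots,T_t)$-even cut $C$ by exhaustive search and return $C$. Step 3: if $G$ has no edge, return $\emptyset$. Step 4: choose an edge $e$ of $G$ uniformly at random, replace the instance by $(G;T_1,\ldots,T_t)/e$, and repeat from Step 1. (Edges of contracted graphs are identified with edges of the original graph.) *)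

(* Defs.v *)
From HB Require Import structures.
From mathcomp Require Import all_boot all_order all_algebra.

Set Implicit Arguments.
Unset Strict Implicit.
Unset Printing Implicit Defensive.

Import Order.TTheory GRing.Theory Num.Theory.

(* Finite undirected multigraphs, loops and parallel edges allowed. Edges are
   elements of a fixed label type E, so that after deletions and contractions
   the remaining edges are still edges of the original graph. The order of the
   two components of [ends e] is irrelevant, and so is the value of [ends]
   outside [edges]. *)
Record mgraph (E : finType) := MGraph {
  vert : finType;
  edges : {set E};
  ends : E -> vert * vert }.

Definition cut (E : finType) (G : mgraph E) (X : {set vert G}) : {set E} :=
  [set e in edges G | ((ends G e).1 \in X) (+) ((ends G e).2 \in X)].

(* (G; T_1, ..., T_t) *)
Record instance (E : finType) (t : nat) := Instance {
  igraph :> mgraph E;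
  term : 'I_t -> {set vert igraph} }.

Definition even_cut (E : finType) (t : nat) (I : instance E t) (C : {set E}) :
    bool :=
  [exists X : {set vert I},
    [&& X != set0, X != setT, [forall i, ~~ odd #|term I i :&: X|]
      & C == cut X]].

Definition min_even_cut (E : finType) (t : nat) (I : instance E t)
    (C : {set E}) : bool :=
  even_cut I C && [forall D : {set E}, even_cut I D ==> (#|C| <= #|D|)].

Definition loopless_graph (E : finType) (G : mgraph E) : mgraph E :=
  @MGraph E (vert G) [set e in edges G | (ends G e).1 != (ends G e).2]
    (ends G).

Definition delete_loops (E : finType) (t : nat) (I : instance E t) :
    instance E t :=
  @Instance E t (loopless_graph I) (term I).

(* [None] is the new vertex z. *)
Definition contract_vert (V : finType) (x y : V) : finType :=
  option {v : V | (v != x) && (v != y)}.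

(* [insub v] is [None] when v is x or y, and v itself otherwise. *)
Definition contract_graph (E : finType) (G : mgraph E) (e : E) : mgraph E :=
  let V' := contract_vert (ends G e).1 (ends G e).2 in
  @MGraph E V' (edges G :\ e)
    (fun f => (insub (ends G f).1 : V', insub (ends G f).2 : V')).

Definition contract_set (V : finType) (x y : V) (T : {set V}) :
    {set contract_vert x y} :=
  let A := [set u : contract_vert x y | if u is Some v then val v \in T
                                        else false] in
  if odd #|A| then None |: A else A.

Lemma contract_setP (V : finType) (x y : V) (T : {set V})
    (U : {set contract_vert x y}) :
  U = contract_set x y T <->
  ~~ odd #|U| /\
  (forall v : {v : V | (v != x) && (v != y)}, (Some v \in U) = (val v \in T)).
Proof.
rewrite /contract_set; set A := [set u | _].
have NA : None \notin A by rewrite inE.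
have AU (W : {set contract_vert x y}) : (forall v : {v : V | (v != x) && (v != y)},
    (Some v \in W) = (val v \in T)) -> W :\ None = A.
  by move=> WT; apply/setP=> -[v|]; rewrite !inE //= WT.
split=> [->|[evU UT]].
  split; first by case: ifP => [oA|->] //; rewrite cardsU1 NA /= oA.
  by move=> v; case: ifP => _; rewrite !inE.
move: evU; rewrite (cardsD1 None) (AU _ UT) oddD -(AU _ UT).
case: (boolP (None \in U)) => NU /=.
  by rewrite negbK => ->; rewrite setD1K.
by move=> /negbTE ->; apply/setP=> -[v|]; rewrite !inE //= (negbTE NU).
Qed.

Definition contract (E : finType) (t : nat) (I : instance E t) (e : E) :
    instance E t :=
  @Instance E t (contract_graph I e)
    (fun i => contract_set (ends I e).1 (ends I e).2 (term I i)).

(* The way exhaustive search chooses among several minimum even cuts is left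
   arbitrary; when there is no even cut, nothing is said about its result. *)
Definition exhaustive_search (E : finType) (t : nat)
    (search : instance E t -> {set E}) : Prop :=
  forall I : instance E t,
    (exists C, even_cut I C) -> min_even_cut I (search I).

Local Open Scope ring_scope.

Definition point_mass (R : nzRingType) (S : eqType) (s : S) : S -> R :=
  fun s' => (s' == s)%:R.

Definition uniform_mix (R : unitRingType) (E S : finType) (A : {set E})
    (p : E -> S -> R) : S -> R :=
  fun s => (#|A|%:R)^-1 * \sum_(e in A) p e s.

(* Probability mass function of the set of edges returned by one run. Each
   contraction removes an edge, so with fuel at least the number of edges the
   fuel is never exhausted while an edge remains: see [rca_lawE]. *)
Fixpoint rca_law_rec (R : unitRingType) (E : finType) (t : nat)
    (search : instance E t -> {set E}) (fuel : nat) (I : instance E t) :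
    {set E} -> R :=
  let I1 := delete_loops I in
  if (#|vert I1| <= 2 ^ t + 4)%N then point_mass R (search I1)
  else if edges I1 == set0 then point_mass R set0
  else if fuel is fuel'.+1 then
    uniform_mix (edges I1)
      (fun e => rca_law_rec R search fuel' (contract I1 e))
  else fun=> 0.

Definition rca_law (R : unitRingType) (E : finType) (t : nat)
    (search : instance E t -> {set E}) (I : instance E t) : {set E} -> R :=
  rca_law_rec R search #|edges I| I.

Lemma rca_law_recE (R : unitRingType) (E : finType) (t : nat)
    (search : instance E t -> {set E}) (n : nat) (I : instance E t) :
  (#|edges I| <= n)%N -> rca_law_rec R search n I =1 rca_law R search I.
Proof.
have edgesC (J : instance E t) e : e \in edges (delete_loops J) ->
    (#|edges (contract (delete_loops J) e)| < #|edges J|)%N.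
  move=> eJ; apply: (@leq_trans #|edges (delete_loops J)|).
    by rewrite [X in (_ < X)%N](cardsD1 e) eJ ltnS.
  by apply/subset_leq_card/subsetP=> f; rewrite inE => /andP[].
suff fuelE m (J : instance E t) : (#|edges J| <= n)%N -> (#|edges J| <= m)%N ->
    rca_law_rec R search n J =1 rca_law_rec R search m J.
  by move=> leIn; apply: fuelE.
elim: n m J => [|n IHn] [|m] J leJn leJm C //=; case: ifP => // _;
  case: (boolP (_ == set0)) => //= /set0Pn[e0 /edgesC ltJ].
- by have := leq_trans ltJ leJn.
- by have := leq_trans ltJ leJm.
rewrite /uniform_mix; congr (_ * _); apply: eq_bigr => e /edgesC lteJ.
by apply: IHn; rewrite -ltnS; apply: leq_trans lteJ _.
Qed.

Lemma rca_lawE (R : unitRingType) (E : finType) (t : nat)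
    (search : instance E t -> {set E}) (I : instance E t) :
  rca_law R search I =1
  let I1 := delete_loops I in
  if (#|vert I1| <= 2 ^ t + 4)%N then point_mass R (search I1)
  else if edges I1 == set0 then point_mass R set0
  else uniform_mix (edges I1) (fun e => rca_law R search (contract I1 e)).
Proof.
move=> C; rewrite -(@rca_law_recE _ _ _ _ #|edges I|.+1) //=.
case: ifP => // _; case: ifP => // _.
rewrite /uniform_mix; congr (_ * _); apply: eq_bigr => e eI.
apply: rca_law_recE; apply: leq_trans (subset_leq_card (subsetDl _ _)) _.
by apply/subset_leq_card/subsetP=> f; rewrite inE => /andP[].
Qed.

From mathcomp Require Import all_classical all_reals all_analysis.

Local Open Scope classical_set_scope.

Definition has_law (d : measure_display) (T : measurableType d) (R : realType)
    (P : probability T R) (S : finType) (X : T -> S) (p : S -> R) : Prop :=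
  forall s : S,
    measurable (X @^-1` [set s]) /\ P (X @^-1` [set s]) = (p s)%:E.

Definition mutually_independent (d : measure_display) (T : measurableType d)
    (R : realType) (P : probability T R) (I S : finType) (X : I -> T -> S) :
    Prop :=
  forall (J : {set I}) (A : I -> {set S}),
    P [set w | forall i, i \in J -> X i w \in A i] =
    (\prod_(i in J) fine (P [set w | X i w \in A i]))%:E.

(* Main.v *)
(** Even cuts of a contraction [I / e] are exactly the even cuts of [I] avoiding
    [e].  So a fixed minimum even cut, of size [k], survives a contraction step
    unless one of its [k] edges is chosen, and while it survives the minimum is
    unchanged.  With [n] vertices and [m] edges left, [k (n - 2 ^ t) <= 4 m], so
    this happens with probability at most [4 / (n - 2 ^ t)].  The product of
    [1 - 4 / (n - 2 ^ t)] over the steps telescopes to [1 / 'C(n - 2 ^ t, 4)],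
    at least [24 / n ^ 4]; hence [c n ^ 4] independent runs all fail with
    probability at most [(1 - 24 / n ^ 4) ^ (c n ^ 4) <= exp (- 24 c)]. *)
Require Import Defs.
From mathcomp Require Import all_boot all_order all_algebra.
From mathcomp Require Import zify.

Set Implicit Arguments.
Unset Strict Implicit.
Unset Printing Implicit Defensive.

Import Order.TTheory GRing.Theory Num.Theory.

(** * Projection of the vertices onto a contraction *)

Section ContractProj.
Variables (V : finType) (x y : V).

Definition contract_proj (v : V) : contract_vert x y := insub v.

Lemma contract_proj_eqN v : (contract_proj v == None) = (v == x) || (v == y).
Proof.
rewrite /contract_proj; case: insubP => [u /andP[/negbTE-> /negbTE->]|] //.
by rewrite negb_and !negbK => ->; rewrite eqxx.
Qed.

Lemma contract_proj_val (v : {v : V | (v != x) && (v != y)}) :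
  contract_proj (val v) = Some v.
Proof. by rewrite /contract_proj valK. Qed.

Lemma contract_projx : contract_proj x = None.
Proof. by apply/eqP; rewrite contract_proj_eqN eqxx. Qed.

Lemma contract_projy : contract_proj y = None.
Proof. by apply/eqP; rewrite contract_proj_eqN eqxx orbT. Qed.

Lemma contract_proj_surj u : exists v, contract_proj v = u.
Proof.
case: u => [v|]; first by exists (val v); rewrite contract_proj_val.
by exists x; rewrite contract_projx.
Qed.

Lemma contract_proj_inj v w :
  contract_proj v != None -> contract_proj v = contract_proj w -> v = w.
Proof.
rewrite /contract_proj; case: insubP => // u _ <- _.
by case: insubP => // u' _ <- [->].
Qed.

Lemma card_contract_vert :
  x != y -> #|contract_vert x y| = #|V|.-1.
Proof.
move=> xy; rewrite card_option card_sig.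
rewrite (@eq_card _ _ (~: [set x; y])); last first.
  by move=> v; rewrite !inE negb_or.
have := cardsC [set x; y]; rewrite cards2 xy /=; lia.
Qed.

Lemma odd_contract_set (T : {set V}) : ~~ odd #|contract_set x y T|.
Proof. by case: (contract_setP T (contract_set x y T)).1. Qed.

Lemma in_contract_set (T : {set V}) v :
  contract_proj v != None -> (contract_proj v \in contract_set x y T) = (v \in T).
Proof.
have [_ h] := (contract_setP T (contract_set x y T)).1 erefl.
by rewrite /contract_proj; case: insubP => // u _ <- _; rewrite h.
Qed.

Lemma odd_contract_setI (T : {set V}) (X : {set contract_vert x y}) :
  ~~ odd #|T| ->
  odd #|contract_set x y T :&: X| = odd #|T :&: (contract_proj @^-1: X)|.
Proof.
move=> evT.
(* Off the vertex [None] the projection is injective, so the two sets are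
   equinumerous when [None] is not in [X]; otherwise pass to complements, which
   preserves parity because both terminal sets are even. *)
have [NX|NX] := boolP (None \in X); last first.
  have ne v : contract_proj v \in X -> contract_proj v != None.
    by apply: contraTneq => ->.
  rewrite -(@card_in_imset _ _ contract_proj (T :&: _)); last first.
    by move=> v w /setIP[_]; rewrite inE => /ne vN _; apply: contract_proj_inj.
  congr (odd #|pred_of_set _|); apply/setP=> u; apply/setIP/imsetP.
    move=> []; have [v <-] := contract_proj_surj u => vT vX.
    by exists v => //; rewrite !inE vX -in_contract_set ?vT ?ne.
  by case=> v; rewrite !inE => /andP[vT vX] ->; rewrite in_contract_set ?ne.
have ne v : contract_proj v \notin X -> contract_proj v != None.
  by apply: contraNneq => ->.
have E : #|contract_set x y T :\: X| = #|T :\: (contract_proj @^-1: X)|.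
  rewrite -(@card_in_imset _ _ contract_proj (T :\: _)); last first.
    move=> v w /setDP[_]; rewrite inE => /ne vN _; exact: contract_proj_inj.
  congr (#|pred_of_set _|); apply/setP=> u; apply/setDP/imsetP.
    move=> []; have [v <-] := contract_proj_surj u => vT vX.
    by exists v => //; rewrite !inE vX -in_contract_set ?vT ?ne.
  case=> v; rewrite !inE => /andP[vX vT] ->; rewrite in_contract_set ?ne //.
have := odd_contract_set T; move: evT.
rewrite -(cardsID X (contract_set x y T)) -(cardsID (contract_proj @^-1: X) T).
by rewrite E !oddD; do 3!case: odd.
Qed.

End ContractProj.

(** * Even cuts under loop deletion and contraction, and a lower bound on the number of edges *)

Section EvenCuts.
Variables (E : finType) (t : nat).
Implicit Types (I : instance E t) (C D : {set E}).

Lemma even_cutP I C :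
  reflect (exists X : {set vert I}, [/\ X != set0, X != setT,
             forall i, ~~ odd #|term I i :&: X| & C = cut X])
          (even_cut I C).
Proof.
apply: (iffP existsP) => -[X].
  by case/and4P=> ? ? /forallP ? /eqP ?; exists X.
by case=> ? ? ? ->; exists X; apply/and4P; split=> //; apply/forallP.
Qed.

Lemma cut_delete_loops I (X : {set vert I}) :
  @cut E (delete_loops I) X = cut X.
Proof.
apply/setP=> e; rewrite !inE /=; case: eqP => [->|]; last by rewrite andbT.
by rewrite addbb !andbF.
Qed.

Lemma even_cut_delete_loops I C : even_cut (delete_loops I) C = even_cut I C.
Proof. by apply: eq_existsb => X; rewrite cut_delete_loops. Qed.

(** Both ends of [e] project to [None], so [e] does not cross the preimage either. *)
Lemma cut_contract I e (X : {set vert (contract I e)}) :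
  cut X = @cut E I (@contract_proj _ (ends I e).1 (ends I e).2 @^-1: X).
Proof.
apply/setP=> f; rewrite !inE /=; case: (eqVneq f e) => //= ->.
by rewrite -/(contract_proj _ _ _) -/(contract_proj _ _ _) contract_projx
  contract_projy addbb !andbF.
Qed.

(** Preimages under [contract_proj] match the vertex sets of the contraction with those that do not
    separate the ends of [e]; parities agree by [odd_contract_setI]. *)
Lemma even_cut_contract I e C :
  (forall i, ~~ odd #|term I i|) -> e \in edges I ->
  even_cut (contract I e) C = even_cut I C && (e \notin C).
Proof.
move=> evT eI; set x := (ends I e).1; set y := (ends I e).2.
have pre0 (X : {set contract_vert x y}) :
    (contract_proj x y @^-1: X == set0) = (X == set0).
  apply/eqP/eqP => [X0|->]; last by apply/setP=> v; rewrite !inE.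
  apply/setP=> u; have [v <-] := contract_proj_surj u.
  by move/setP/(_ v): X0; rewrite !inE.
have preT (X : {set contract_vert x y}) :
    (contract_proj x y @^-1: X == setT) = (X == setT).
  apply/eqP/eqP => [X0|->]; last by apply/setP=> v; rewrite !inE.
  apply/setP=> u; have [v <-] := contract_proj_surj u.
  by move/setP/(_ v): X0; rewrite !inE.
apply/even_cutP/andP => [[X [X0 XT Xev ->]]|[/even_cutP[X [X0 XT Xev ->]]]].
  rewrite cut_contract; split.
    apply/even_cutP; exists (contract_proj x y @^-1: X).
    rewrite pre0 preT; split=> // i.
    by rewrite -odd_contract_setI //; apply: Xev.
  by rewrite !inE contract_projx contract_projy addbb andbF.
rewrite inE eI /= -/x -/y negb_add => /eqP xyX.
(* Since [x] and [y] lie on the same side of [X], either one may decide the membership of [None]. *)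
pose X' : {set contract_vert x y} :=
  [set u | if u is Some v then val v \in X else x \in X].
have XE : contract_proj x y @^-1: X' = X.
  apply/setP=> v; rewrite !inE; have := contract_proj_eqN x y v.
  rewrite /contract_proj; case: insubP => [u _ -> //|_] /=.
  by rewrite eqxx => /esym/orP[]/eqP->.
exists X'; split.
- by rewrite -pre0 XE.
- by rewrite -preT XE.
- by move=> i; rewrite /= odd_contract_setI // XE.
- by rewrite cut_contract -/x -/y XE.
Qed.

(** An edge lies in at most two of these cuts, those of its ends; a loop lies in none, hence only an
    inequality. *)
Lemma sum_card_cut1 (G : mgraph E) :
  \sum_(v : vert G) #|cut [set v]| <= 2 * #|edges G|.
Proof.
have cutE (v : vert G) : #|cut [set v]| =
    \sum_(e in edges G) (((ends G e).1 == v) (+) ((ends G e).2 == v)).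
  rewrite -sum1_card [RHS]big_mkcond /= big_mkcond; apply: eq_bigr => e _.
  by rewrite !inE; case: (e \in _) => //=; case: (_ (+) _).
rewrite (eq_bigr _ (fun v _ => cutE v)) exchange_big /= mulnC -sum_nat_const.
apply: leq_sum => e _.
apply: (@leq_trans (\sum_v (((ends G e).1 == v) + ((ends G e).2 == v)))).
  by apply: leq_sum => v _; do 2!case: (_ == _).
have sum1 (w : vert G) : \sum_v (w == v) = 1.
  by rewrite (bigD1 w) //= eqxx big1 // => v; rewrite eq_sym => /negbTE->.
by rewrite big_split /= !sum1.
Qed.


(* Two vertices lying in the same sets [T_i] form an even set, so their degrees
   add up to at least [k]: the vertices of degree below [k / 2] are pairwise
   distinguished by the [2 ^ t] possible membership patterns. *)
Lemma edges_lower_bound I k :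
  2 < #|vert I| -> (forall C, even_cut I C -> k <= #|C|) ->
  k * (#|vert I| - 2 ^ t) <= 4 * #|edges I|.
Proof.
move=> V2 kmin; pose deg (v : vert I) := #|cut [set v]|.
pose B := [set v | 2 * deg v < k].
pose pattern (v : vert I) := [ffun i : 'I_t => v \in term I i].
have injB : {in B &, injective pattern}.
  move=> u v; rewrite !inE => du dv /ffunP tuv; apply/eqP/negPn/negP => uv.
  have /kmin : even_cut I (cut [set u; v]).
    apply/even_cutP; exists [set u; v]; split=> //.
    - by apply/set0Pn; exists u; rewrite !inE eqxx.
    (* A pair is a proper vertex set because there are more than two vertices. *)
    - by apply: contraTneq V2 => uvT; rewrite -cardsT -uvT cards2 uv.
    - move=> i; move: (tuv i); rewrite !ffunE.
      have [uT /esym vT|/negbTE uT /esym vT] := boolP (u \in term I i).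
        suff /setIidPr-> : [set u; v] \subset term I i by rewrite cards2 uv.
        by apply/subsetP=> w; rewrite !inE => /orP[]/eqP->.
      rewrite (_ : _ :&: _ = set0) ?cards0 //; apply/setP=> w; rewrite !inE.
      by apply/negbTE/negP=> /andP[+ /orP[]/eqP wE]; rewrite wE ?uT ?vT.
  have : #|cut [set u; v]| <= deg u + deg v.
    apply: leq_trans (leq_card_setU _ _).
    apply/subset_leq_card/subsetP=> e; rewrite !inE.
    by case: (e \in _) => //=; do 4!case: (_ == _).
  by lia.
have cB : #|B| <= 2 ^ t.
  rewrite -(card_in_imset injB); apply: leq_trans (max_card _) _.
  by rewrite card_ffun card_bool card_ord.
(* Each of the at least [#|vert I| - 2 ^ t] vertices outside [B] has degree at least [k / 2], and
   all degrees add up to at most [2 * #|edges I|]. *)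
have : \sum_(v in ~: B) k <= \sum_(v in ~: B) 2 * deg v.
  by apply: leq_sum => v; rewrite !inE -leqNgt.
have : \sum_(v in ~: B) 2 * deg v <= 2 * \sum_v deg v.
  by rewrite big_distrr [leqRHS](bigID (mem (~: B))) leq_addr.
have cBC : #|~: B| = #|vert I| - #|B| by rewrite cardsCs setCK.
have : \sum_v deg v <= 2 * #|edges I| := sum_card_cut1 I.
rewrite sum_nat_const cBC.
have : k * (#|vert I| - 2 ^ t) <= k * (#|vert I| - #|B|).
  by rewrite leq_mul2l leq_sub2l ?orbT.
rewrite (mulnC (_ - #|B|) k); lia.
Qed.

End EvenCuts.

(** * Success probability of a single run *)

Section SuccessProbability.
Variables (R : realFieldType) (E : finType) (t : nat).
Variable (search : instance E t -> {set E}).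
Hypothesis hsearch : exhaustive_search search.
Local Open Scope ring_scope.

Lemma rca_law_ge0 (I : instance E t) C : 0 <= rca_law R search I C.
Proof.
have pm0 (D : {set E}) : 0 <= point_mass R D C by rewrite ler0n.
rewrite /rca_law; move: #|edges I| => n; elim: n I => [|n IHn] I /=;
  do 2!case: ifP => // _.
by rewrite mulr_ge0 ?invr_ge0 ?ler0n // sumr_ge0.
Qed.

Lemma sum_point_mass (S : finType) (s : S) (A : pred S) :
  A s -> \sum_(x | A x) point_mass R s x = 1.
Proof.
move=> As; rewrite (bigD1 s) //= /point_mass eqxx big1 ?addr0 //.
by move=> x /andP[_ /negbTE->].
Qed.

(** Induction on the number of edges. The sum covers all even cuts of size [k], since the search may
    return any of them. [maxn 4] keeps the binomial coefficient positive, so the bound is 1 on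
    instances small enough for exhaustive search. *)
Lemma rca_success_lower_bound (I : instance E t) (k : nat) :
  (forall i, ~~ odd #|term I i|) ->
  (exists2 C, even_cut I C & #|C| = k) ->
  (forall C, even_cut I C -> k <= #|C|)%N ->
  ('C(maxn 4 (#|vert I| - 2 ^ t), 4))%:R^-1 <=
  \sum_(C | even_cut I C && (#|C| == k)) rca_law R search I C.
Proof.
have [n] := ubnP #|edges I|; elim: n I => // n IHn I In evT [C0 evC0 cC0] kmin.
rewrite (eq_bigr _ (fun C _ => rca_lawE R search I C)) /=.
set I1 := delete_loops I.
have ev1 C : even_cut I1 C = even_cut I C by apply: even_cut_delete_loops.
case: ifPn => [small|].
  rewrite sum_point_mass.
    by rewrite invf_le1 ?ler1n ?ltr0n bin_gt0 leq_maxl.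
  have /hsearch/andP[sev /forallP smin] : exists C, even_cut I1 C.
    by exists C0; rewrite ev1.
  rewrite -ev1 sev eqn_leq kmin -?ev1 // -cC0 andbT.
  by apply: (implyP (smin C0)); rewrite ev1.
have C0S : C0 \subset edges I1.
  move: evC0; rewrite -ev1 => /even_cutP[X [_ _ _ ->]].
  by apply/subsetP=> e; rewrite inE => /andP[].
rewrite -ltnNge -[X in (_ < X)%N]/#|vert I| => big; case: ifPn => [/eqP noedge|edge].
  (* Without edges [C0] is empty, so the returned [set0] is a minimum even cut. *)
  have C00 : C0 = set0 by apply/eqP; rewrite -subset0 -noedge.
  rewrite sum_point_mass ?invf_le1 ?ler1n ?ltr0n ?bin_gt0 ?leq_maxl //.
  by rewrite -C00 evC0 cC0 eqxx.
(* [b] is the inductive bound with one vertex less; [maxn 4] disappears because at least [2 ^ t + 5]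
   vertices are left. *)
set m := #|edges I1|; set b : R := ('C(#|vert I| - 2 ^ t - 1, 4))%:R^-1.
have m0 : (0 < m)%N by rewrite card_gt0.
have mN : (k * (#|vert I| - 2 ^ t) <= 4 * m)%N.
  by apply: (@edges_lower_bound _ _ I1) => [|C];
    [apply: leq_trans big; lia | rewrite ev1; apply: kmin].
have step e : e \in edges I1 -> e \notin C0 ->
    b <= \sum_(C | even_cut I C && (#|C| == k)) rca_law R search (contract I1 e) C.
  move=> eI eC0; have evE C : even_cut (contract I1 e) C = even_cut I C && (e \notin C).
    by rewrite even_cut_contract // ev1.
  have vE : #|vert (contract I1 e)| = #|vert I|.-1.
    by rewrite card_contract_vert //; move: eI; rewrite inE => /andP[].
  apply: le_trans (_ : \sum_(C | even_cut (contract I1 e) C && (#|C| == k))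
    rca_law R search (contract I1 e) C <= _).
    apply: le_trans (IHn (contract I1 e) _ _ _ _).
    - rewrite vE /b; have -> // :
          maxn 4 (#|vert I|.-1 - 2 ^ t) = (#|vert I| - 2 ^ t - 1)%N.
      by lia.
    - apply: leq_trans (_ : m <= n)%N.
        by rewrite /m [X in (_ <= X)%N](cardsD1 e) eI.
      rewrite -ltnS; apply: leq_ltn_trans In; apply/subset_leq_card/subsetP=> f.
      by rewrite inE => /andP[].
    - by move=> i; apply: odd_contract_set.
    - by exists C0; rewrite ?evE ?evC0.
    - by move=> C; rewrite evE => /andP[/kmin].
  (* The cuts of [I] that contain [e] are dropped; their terms are nonnegative. *)
  rewrite [leRHS](bigID (fun C : {set E} => e \notin C)) /=.
  rewrite [leLHS](eq_bigl (fun C => even_cut I C && (#|C| == k) && (e \notin C))).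
    by rewrite lerDl sumr_ge0 // => C _; apply: rca_law_ge0.
  by move=> C; rewrite evE andbAC.
rewrite /uniform_mix -big_distrr exchange_big /=.
(* The [m - k] edges outside [C0] contribute at least [b] each, those of [C0] at least 0. *)
apply: (@le_trans _ _ (m%:R^-1 * ((m - k)%N%:R * b))); last first.
  rewrite ler_wpM2l ?invr_ge0 ?ler0n //.
  rewrite (bigID (mem C0)) /= addrC -[leLHS]addr0 lerD //; last first.
    by rewrite !sumr_ge0 // => e _; apply: sumr_ge0 => C _; apply: rca_law_ge0.
  apply: (@le_trans _ _ (\sum_(e in edges I1 :\: C0) b)).
    by rewrite sumr_const cardsD (setIidPr C0S) cC0 mulr_natl.
  rewrite [leRHS](eq_bigl (fun e => e \in edges I1 :\: C0)).
    by apply: ler_sum => e /setDP[]; apply: step.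
  by move=> e; rewrite !inE andbC.
rewrite /b; move: mN; set N := (#|vert I| - 2 ^ t)%N => mN.
have N5 : (5 <= N)%N by lia.
have -> : maxn 4 N = N by lia.
have binN : (N * 'C(N - 1, 4) = (N - 4) * 'C(N, 4))%N.
  by rewrite subn1 mul_bin_down.
have km : (k <= m)%N by rewrite -cC0 subset_leq_card.
have binm : (m * 'C(N - 1, 4) <= (m - k) * 'C(N, 4))%N.
  (* After multiplication by [N], [binN] reduces the claim to [m * (N - 4) <= N * (m - k)], which
     follows from [mN]. *)
  rewrite -(@leq_pmul2l N); last by lia.
  rewrite mulnCA binN !mulnA leq_mul2r; apply/orP; right.
  rewrite !mulnBr; lia.
rewrite mulrA [_ * _%:R]mulrC -mulrA -invfM -natrM.
rewrite -[leLHS]mul1r ler_pdivrMr ?ltr0n ?bin_gt0; last by lia.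
rewrite mulrAC ler_pdivlMr ?mul1r -?natrM ?ler_nat //.
by rewrite ltr0n muln_gt0 m0 bin_gt0; lia.
Qed.

End SuccessProbability.

(* Independent runs and the exponential bound *)
From mathcomp Require Import all_classical all_reals all_analysis.

Local Open Scope classical_set_scope.
Local Open Scope ring_scope.

Lemma has_law_mem (d : measure_display) (T : measurableType d) (R : realType)
    (P : probability T R) (S : finType) (X : T -> S) (p : S -> R) (A : {set S}) :
  has_law P X p -> P [set w | X w \in A] = (\sum_(s in A) p s)%:E.
Proof.
move=> lawX; have -> : [set w | X w \in A] =
    \bigcup_(s in [set` enum A]) X @^-1` [set s].
  apply/seteqP; split=> w /=; first by exists (X w) => //=; rewrite mem_enum.
  by case=> s /=; rewrite mem_enum => sA ->.
rewrite measure_fin_bigcup //; last 2 first.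
- exact: trivIset_preimage1.
- by move=> s _; case: (lawX s).
rewrite -fsbig_seq ?enum_uniq // big_enum /= -sumEFin.
by apply: eq_bigr => s _; case: (lawX s).
Qed.

(** The existence of a random variable with law [p] yields the total mass, with no induction on the
    algorithm. *)
Lemma has_law_mass (d : measure_display) (T : measurableType d) (R : realType)
    (P : probability T R) (S : finType) (X : T -> S) (p : S -> R) :
  has_law P X p -> \sum_s p s = 1.
Proof.
move=> /(has_law_mem [set: S]%SET); rewrite (_ : [set w | _] = setT).
  rewrite probability_setT => -[->].
  by apply: eq_bigl => s; rewrite inE.
by apply/seteqP; split=> w //= _; rewrite inE.
Qed.

Lemma mutually_independent_avoid (d : measure_display) (T : measurableType d)
    (R : realType) (P : probability T R) (n : nat) (S : finType)
    (X : 'I_n -> T -> S) (p : S -> R) (A : pred S) :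
  (forall j, has_law P (X j) p) -> mutually_independent P X ->
  P [set w | forall j, ~ A (X j w)] = ((1 - \sum_(s | A s) p s) ^+ n)%:E.
Proof.
move=> lawX indX; pose B : {set S} := [set s | ~~ A s]%SET.
have -> : [set w | forall j, ~ A (X j w)] =
    [set w | forall j, j \in [set: 'I_n]%SET -> X j w \in B].
  apply/seteqP; split=> w /= h j; first by rewrite !inE => _; apply/negP.
  by have := h j; rewrite !inE => /(_ erefl)/negP.
rewrite (indX [set: 'I_n]%SET (fun=> B)); congr (_%:E).
rewrite (eq_bigr (fun=> 1 - \sum_(s | A s) p s)).
  by rewrite prodr_const cardsT card_ord.
move=> j _; rewrite (has_law_mem _ (lawX j)) /= -(has_law_mass (lawX j)).
rewrite [X in X - _](bigID A) /= addrAC subrr add0r.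
by apply: eq_bigl => s; rewrite inE.
Qed.

(** From [1 - x <= expR (- x)] and ['C(m, 4) <= m ^ 4 / 24 <= n ^ 4 / 24], where 24 is [4!]. *)
Lemma one_run_failure_bound (R : realType) (m n : nat) (p : R) :
  (m <= n)%N -> (0 < n)%N -> ('C(maxn 4 m, 4))%:R^-1 <= p ->
  1 - p <= expR (- (24 / (n ^ 4)%N%:R)).
Proof.
move=> mn n0; have n40 : 0 < (n ^ 4)%N%:R :> R by rewrite ltr0n expn_gt0 n0.
have [m4|m4] := leqP m 4.
  (* Here the hypothesis forces [1 <= p], so the left side is at most 0. *)
  rewrite binn invr1 => hp.
  by apply: le_trans (expR_ge0 _); rewrite subr_le0.
move=> hp; apply: le_trans (expR_ge1Dx _); rewrite lerD2l lerN2; apply: le_trans hp.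
rewrite ler_pdivrMr // ler_pdivlMl ?ltr0n ?bin_gt0 1?ltnW //.
rewrite -natrM ler_nat (bin_ffact m 4) ffact_prod !big_ord_recr big_ord0 /=.
rewrite mul1n !expnS expn0 muln1 !mulnA.
by rewrite !leq_mul // (leq_trans (leq_subr _ _)).
Qed.

Theorem theorem2p3 (R : realType) (t c : nat) (ht : (0 < t)%N) (hc : (0 < c)%N)
    (E : finType) (I : instance E t)
    (hT : forall i : 'I_t, ~~ odd #|term I i|)
    (hex : exists C : {set E}, even_cut I C)
    (k : nat)
    (hk : exists2 C : {set E}, min_even_cut I C & #|C| = k)
    (search : instance E t -> {set E}) (hsearch : exhaustive_search search)
    (d : measure_display) (Omega : measurableType d)
    (P : probability Omega R)
    (run : 'I_(c * #|vert I| ^ 4) -> Omega -> {set E})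
    (hlaw : forall j, has_law P (run j) (rca_law R search I))
    (hindep : mutually_independent P run) :
  (P [set w | forall j, ~ (even_cut I (run j w) /\ #|run j w| = k)] <=
   (expR (- (24 * c%:R)))%:E)%E.
Proof.
have [C0 /andP[evC0 /forallP minC0] cC0] := hk.
have kmin C : even_cut I C -> (k <= #|C|)%N.
  by rewrite -cC0; apply: (implyP (minC0 C)).
have V0 : (0 < #|vert I|)%N.
  have /even_cutP[X [/set0Pn[v _] _ _ _]] := evC0.
  by apply/card_gt0P; exists v.
have := rca_success_lower_bound R hsearch hT (ex_intro2 _ _ C0 evC0 cC0) kmin.
move=> /(one_run_failure_bound (leq_subr _ _) V0) fail1.
rewrite (_ : [set w | _] = [set w | forall j, ~ (even_cut I (run j w) &&
    (#|run j w| == k))]); last first.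
  apply/seteqP; split=> w /= h j; apply: contra_not (h j).
    by move=> /andP[? /eqP].
  by case=> -> ->; rewrite eqxx.
rewrite (mutually_independent_avoid (fun C => even_cut I C && (#|C| == k))
  hlaw hindep) lee_fin.
(* Raising [fail1] to a power needs a nonnegative base. The total mass is read off the first run,
   which exists because [c] and the number of vertices are positive. *)
have fail0 : 0 <= 1 - \sum_(C | even_cut I C && (#|C| == k)) rca_law R search I C.
  rewrite subr_ge0.
  have n0 : (0 < c * #|vert I| ^ 4)%N by rewrite muln_gt0 hc expn_gt0 V0.
  rewrite -(has_law_mass (hlaw (Ordinal n0))) [leRHS](bigID (fun C : {set E} =>
    even_cut I C && (#|C| == k))) /= lerDl sumr_ge0 // => C _.
  exact: rca_law_ge0.
apply: le_trans (lerXn2r _ fail0 (expR_ge0 _) fail1) _.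
have V4 : (#|vert I| ^ 4)%N%:R != 0 :> R by rewrite pnatr_eq0 -lt0n expn_gt0 V0.
rewrite -expRM_natl natrM -mulrA mulrN [_ * (24 / _)]mulrC divfK // mulrN.
by rewrite mulrC lexx.
Qed.
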